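(* For all positive integers $n,N$ with $N\geq\left\lfloor\frac{5}{2}n\right\rfloor-1$, \[ st(n,N)=\left\lceil\frac{\lceil n/2\rceil+N-1}{2}\right\rceil. \]
   Context: Let $M$ be a matrix with entries in $\{0,1\}$; rows are indexed from top to bottom and columns from left to right. For $c\in\{0,1\}$, a $c$-staircase in $M$ is a sequence $s_1,\dots,s_\ell$ of entries (positions) of $M$, all with value $c$, such that for each $i=1,\dots,\ell-1$ the entry $s_{i+1}$ is either strictly to the right of $s_i$ in the same row, or strictly below $s_i$ in the same column ($s_i$ and $s_{i+1}$ need not be neighbouring positions). Its length is $\ell$, the number of its elements. A homogeneous staircase is a $0$-staircase or a $1$-staircase. $st(M)$ denotes the maximum length of a homogeneous staircase in $M$, and \[ st(n,N)=\min\{st(M): M\in\{0,1\}^{n\times N}\}, \] where $\{0,1\}^{n\times N}$ is the set of $0$-$1$ matrices with $n$ rows and $N$ columns. *)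

(* Defs.v *)
From HB Require Import structures.
From mathcomp Require Import all_boot all_order all_algebra.

Set Implicit Arguments.
Unset Strict Implicit.
Unset Printing Implicit Defensive.

Definition next_step n N (p q : 'I_n * 'I_N) : bool :=
  (p.1 == q.1) && (p.2 < q.2) || (p.2 == q.2) && (p.1 < q.1).

Definition staircase n N (M : 'M[bool]_(n, N)) (c : bool)
    (s : seq ('I_n * 'I_N)) : bool :=
  all (fun p => M p.1 p.2 == c) s && sorted (@next_step n N) s.

Definition homogeneous_staircase n N (M : 'M[bool]_(n, N))
    (s : seq ('I_n * 'I_N)) : bool :=
  staircase M false s || staircase M true s.

(* The bound n * N on the length only serves to make the index type finite; it
   is not a restriction, by [leq_st_mx]. *)
Definition st_mx n N (M : 'M[bool]_(n, N)) : nat :=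
  \max_(s : (n * N).-bseq ('I_n * 'I_N)%type | homogeneous_staircase M s) size s.

(* The constant matrix is only the witness that there is a matrix to minimise
   over. *)
Definition st (n N : nat) : nat :=
  st_mx [arg min_(M < const_mx false : 'M[bool]_(n, N)) st_mx M].

Lemma size_staircase n N (M : 'M[bool]_(n, N)) c s :
  staircase M c s -> size s <= n * N.
Proof.
case/andP=> _ s_sorted.
pose w (p : 'I_n * 'I_N) : nat := p.1 + p.2.
have s_uniq : uniq s.
  apply: (@sorted_uniq _ (relpre w ltn)).
  - by move=> y x z; apply: ltn_trans.
  - by move=> x; apply: ltnn.
  - apply: sub_sorted s_sorted => p q.
    by case/orP=> /andP[/eqP e lt_pq]; rewrite /= /w e ?ltn_add2l ?ltn_add2r.
by rewrite -(card_uniqP s_uniq) (leq_trans (max_card _)) // card_prod !card_ord.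
Qed.

Lemma leq_st_mx n N (M : 'M[bool]_(n, N)) s :
  homogeneous_staircase M s -> size s <= st_mx M.
Proof.
move=> hs; have sz : size s <= n * N by case/orP: hs => /size_staircase.
exact: (@leq_bigmax_cond _ _ (fun t : (n * N).-bseq _ => size t) (Bseq sz)).
Qed.

Lemma st_mx_attained n N (M : 'M[bool]_(n, N)) :
  exists2 s, homogeneous_staircase M s & size s = st_mx M.
Proof.
have h0 : homogeneous_staircase M [bseq of [::] : (n * N).-bseq _] by [].
rewrite /st_mx (bigmax_eq_arg [bseq of [::] : (n * N).-bseq _]) //; case: arg_maxnP => // t ht _.
by exists t.
Qed.

Lemma st_leq n N (M : 'M[bool]_(n, N)) : st n N <= st_mx M.
Proof. by rewrite /st; case: arg_minnP => // M0 _; apply. Qed.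

Lemma st_attained n N : exists M : 'M[bool]_(n, N), st_mx M = st n N.
Proof. by eexists. Qed.

(* Main.v *)
Require Import Defs.
From mathcomp Require Import all_boot all_order all_algebra.
From mathcomp Require Import zify.

(** Write m = [uphalf n] and h = [n./2], so that n = m + h.

    Lower bound. Some colour c occurs at least m times in the first column; let
    r be the last row in which it does. Descend the first column along the
    entries of colour c, turn at row r and continue along the entries of colour
    c of that row. This c-staircase, together with the staircase formed by the
    entries of the other colour in row r, uses each of the N entries of row r
    once and at least m - 1 further entries. The two lengths add up to at least
    m + N - 1, so one of them is at least half of that ([st_mx_lower]).

    Upper bound. In a band that slants down and to the left with slope one,
    a staircase is no longer than the longest row of the band: each step down
    costs one column on the right. The same holds for a region whose left side is vertical
    and whose right side is slanted; only against the vertical right side of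
    the matrix do steps down lengthen a staircase. So the top h rows carry
    a slanted band of ones of width K on a background of zeros, and the bottom
    m rows a slanted band of zeros of width K on a background of ones. In
    either half the background colour takes the remaining N - K columns and
    gains the height of the half minus one on the right side of the matrix,
    which is still at most K as soon as m + N - 1 <= 2 * K. The horizontal
    positions of the bands, the one in the bottom half starting n - 1
    antidiagonals to the right of the one in the top half, are chosen such that
    a staircase that passes from the top half to the bottom half gains nothing
    either, provided that n + h - 1 <= K. This is certified by an explicit
    integer rank with values below K that increases at every step of
    a homogeneous staircase ([band_rank]). The assumption on N makes
    the smallest K allowed by the first inequality satisfy the second one. *)

Lemma sorted_filter_enum_ord {n} (a : pred 'I_n) :
  sorted (fun i j : 'I_n => i < j) [seq i <- enum 'I_n | a i].
Proof.
apply: sorted_filter => [j i k|]; first exact: ltn_trans.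
by have := iota_ltn_sorted 0 n; rewrite -val_enum_ord sorted_map.
Qed.

Definition row_cells {n N} (M : 'M[bool]_(n, N)) c (r : 'I_n) :=
  [seq (r, j) | j <- enum 'I_N & M r j == c].

Definition col_cells {n N} (M : 'M[bool]_(n, N)) c (k : 'I_N) :=
  [seq (i, k) | i <- enum 'I_n & M i k == c].

Lemma staircase_row {n N} (M : 'M[bool]_(n, N)) c r :
  staircase M c (row_cells M c r).
Proof.
apply/andP; split.
  by apply/allP=> _ /mapP[j + ->]; rewrite mem_filter => /andP[].
rewrite sorted_map; apply: sub_sorted (sorted_filter_enum_ord _) => j j' lt_jj'.
by rewrite /next_step /= eqxx lt_jj'.
Qed.

Lemma staircase_col {n N} (M : 'M[bool]_(n, N)) c k :
  staircase M c (col_cells M c k).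
Proof.
apply/andP; split.
  by apply/allP=> _ /mapP[i + ->]; rewrite mem_filter => /andP[].
rewrite sorted_map; apply: sub_sorted (sorted_filter_enum_ord _) => i i' lt_ii'.
by rewrite /next_step /= eqxx lt_ii' orbT.
Qed.

(** Staircases may only be glued at a common entry, because [next_step] is not
    transitive. *)
Lemma staircase_cat {n N} (M : 'M[bool]_(n, N)) {c s p t} :
  staircase M c (rcons s p) -> staircase M c (p :: t) ->
  staircase M c (rcons s p ++ t).
Proof.
case/andP=> Ms s_sorted /andP[/andP[_ Mt] t_path].
apply/andP; split; first by rewrite all_cat Ms.
by case: s s_sorted {Ms} => //= q s; rewrite cat_path last_rcons => ->.
Qed.

Lemma size_row_cells {n N} (M : 'M[bool]_(n, N)) r :
  size (row_cells M false r) + size (row_cells M true r) = N.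
Proof.
rewrite !size_map !size_filter -[RHS](size_enum_ord N).
rewrite -(count_predC (fun j => M r j == false)); congr (_ + _).
by apply: eq_count => j /=; case: (M r j).
Qed.

Lemma size_col_cells {n N} (M : 'M[bool]_(n, N)) k :
  size (col_cells M false k) + size (col_cells M true k) = n.
Proof.
rewrite !size_map !size_filter -[RHS](size_enum_ord n).
rewrite -(count_predC (fun i => M i k == false)); congr (_ + _).
by apply: eq_count => i /=; case: (M i k).
Qed.

Lemma staircase_leq_st_mx {n N} (M : 'M[bool]_(n, N)) {c s} :
  staircase M c s -> size s <= st_mx M.
Proof.
move=> hs; apply: leq_st_mx.
by case: c hs => hs; rewrite /homogeneous_staircase hs ?orbT.
Qed.

(** The majority colour of the first column supplies a staircase with a long
    vertical part; the row in which it turns is shared out between this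
    staircase and the one of the other colour. *)
Lemma st_mx_lower {n N} (M : 'M[bool]_(n.+1, N.+1)) :
  uphalf n.+1 + N <= (st_mx M).*2.
Proof.
have [c hc] : exists c, uphalf n.+1 <= size (col_cells M c ord0).
  have := size_col_cells M ord0.
  have [] := leqP (uphalf n.+1) (size (col_cells M false ord0)).
    by exists false.
  by exists true; lia.
have colS := staircase_col M c ord0.
case/lastP def_col: (col_cells M c ord0) hc colS => [|s p] // hc colS.
have : p \in col_cells M c ord0 by rewrite def_col mem_rcons mem_head.
case/mapP=> r; rewrite mem_filter => /andP[Mr0 _] def_p.
have rowS := staircase_row M c r.
have [t def_row] : exists t, row_cells M c r = p :: t.
  by rewrite /row_cells enum_ordSl /= Mr0 /= -def_p; eexists.
rewrite def_row in rowS.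
have := staircase_leq_st_mx _ (staircase_cat _ colS rowS).
have := staircase_leq_st_mx _ (staircase_row M (~~ c) r).
have : size (row_cells M c r) + size (row_cells M (~~ c) r) = N.+1.
  by have := size_row_cells M r; case: (c) => //=; rewrite addnC.
by rewrite def_row size_cat /=; lia.
Qed.

(** A homogeneous staircase visits entries of pairwise distinct ranks, so a rank
    with values below K that increases along it bounds its length by K. *)
Lemma st_leq_of_rank {n N} (M : 'M[bool]_(n, N)) K (f : 'I_n * 'I_N -> nat) :
  (forall p, f p < K) ->
  (forall p q, M p.1 p.2 = M q.1 q.2 -> next_step p q -> f p < f q) ->
  st n N <= K.
Proof.
move=> f_ltK f_mono; apply: leq_trans (st_leq M) _.
have [s hs <-] := st_mx_attained M.
have {hs} [c /andP[Mc s_sorted]] : exists c, staircase M c s.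
  by case/orP: hs => hs; [exists false | exists true].
have fs_sorted : sorted ltn [seq f p | p <- s].
  rewrite sorted_map; apply: sub_in_sorted _ Mc s_sorted.
  by move=> p q /eqP Mp /eqP Mq; apply: f_mono; rewrite Mp Mq.
rewrite -(size_map f) -(size_iota 0 K); apply: uniq_leq_size.
  exact: sorted_uniq ltn_trans ltnn _ fs_sorted.
by move=> _ /mapP[p _ ->]; rewrite mem_iota f_ltK.
Qed.

(** The entry in row i on the antidiagonal d, that is, in column d - i. The sides
    of the bands are antidiagonals, so within either half only d matters. *)
Definition band_entry (n K i d : nat) : bool :=
  let h := n./2 in
  if i < h then h <= d < h + K else ~~ (n + h - 1 <= d < n + h - 1 + K).

(** What [band_rank] subtracts from d, in each of the three regions of the top
    half and then of the bottom half, from left to right. A band is ranked from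
    0 on its left side. The background to the right of a band continues the
    ranks of the background to its left, as if the band were cut out. In the
    bottom half the background to the left has the same offset as the band of
    ones in the top half, which a 1-staircase may leave downwards into it. *)
Definition band_offset (n K i d : nat) : nat :=
  let h := n./2 in
  if i < h then if d < h then 0 else if d < h + K then h else K
  else if d < n + h - 1 then h
       else if d < n + h - 1 + K then n + h - 1 else h + K.

Definition band_rank (n K i j : nat) : nat :=
  i + j - band_offset n K i (i + j).

(** A band has ranks below K because it has width K. The bound on N is needed at
    the right side of the matrix: in the last
    row of either half, the rank in the last column is N - K plus the height of
    that half, minus two. *)
Lemma band_rank_lt n N K i j :
  uphalf n + N - 1 <= K.*2 -> n + n./2 - 1 <= K -> i < n -> j < N ->
  band_rank n K i j < K.
Proof. by rewrite /band_rank /band_offset /=; do !case: ifP => ?; lia. Qed.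

Lemma band_rank_right n K i j j' :
  n + n./2 - 1 <= K -> i < n ->
  band_entry n K i (i + j) = band_entry n K i (i + j') -> j < j' ->
  band_rank n K i j < band_rank n K i j'.
Proof.
by rewrite /band_rank /band_entry /band_offset /=; do !case: ifP => ?; lia.
Qed.

(** The critical steps go from the top half to the bottom half. A step from the
    upper left zeros to the lower band of zeros is impossible because that band
    stays in columns at least h. A step from the upper right zeros to the lower
    band, from (i, j) to (i', j), has i <= h - 1 and i' >= h, so its rank grows by
    at least K - (n + h - 2), which is where the lower bound on K comes from.
    A step from the upper band of ones to the ones at the lower left keeps the
    offset, and one to the ones at the lower right is impossible, since these
    stay in columns at least h + K. *)
Lemma band_rank_down n K i i' j :
  n + n./2 - 1 <= K -> i' < n ->
  band_entry n K i (i + j) = band_entry n K i' (i' + j) -> i < i' ->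
  band_rank n K i j < band_rank n K i' j.
Proof.
by rewrite /band_rank /band_entry /band_offset /=; do !case: ifP => ?; lia.
Qed.

Lemma st_upper n N K :
  n + n./2 - 1 <= K -> uphalf n + N - 1 <= K.*2 -> st n N <= K.
Proof.
move=> hnK hNK.
pose M : 'M[bool]_(n, N) :=
  (\matrix_(i, j) band_entry n K i (i + j)%N)%R.
apply: (st_leq_of_rank M K (fun p => band_rank n K p.1 p.2)).
  by move=> p; apply: band_rank_lt hNK hnK _ _.
move=> [i j] [i' j']; rewrite !mxE /= => Mpq /orP[]/andP[/eqP /= e lt_pq].
  by rewrite -e in Mpq *; apply: band_rank_right.
by rewrite -e in Mpq *; apply: band_rank_down.
Qed.

Theorem theorem8 (n N : nat) (hn : 0 < n) (hN : 0 < N)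
    (hnN : (5 * n)./2 - 1 <= N) :
  st n N = uphalf (uphalf n + N - 1).
Proof.
apply/eqP; rewrite eqn_leq; apply/andP; split; first by apply: st_upper; lia.
case: n N hn hN {hnN} => [|n] [|N] // _ _.
have [M <-] := st_attained n.+1 N.+1.
by have := st_mx_lower M; lia.
Qed.
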